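(* Let $r\ge0$ be an integer, let $W_0,\dots,W_{r+1}$ be nonnegative numbers such that $\sum_{k=0}^{r+1}W_k=1$, and assume that there are numbers $A_{j+1/2}^n,B_{j+1/2}^n,C_{j,j+k}^n,D_{j-k,j}^n\in\mathbb{R}$ (for each $j\in\mathbb{Z}$, $n\in\mathbb{N}_0$, $k=0,\dots,r+1$) satisfying $$A_{j+1/2}^n,\,B_{j+1/2}^n,\,C_{j,j+k}^n,\,D_{j-k,j}^n\ge0,\qquad (A_{j+1/2}^n+B_{j-1/2}^n)W_0+\sum_{k=1}^{r+1}(C_{j,j+k}^n+D_{j-k,j}^n)\frac1kW_k\le1$$ for all $n,j$. Then solutions $(u_j^n)_{j\in\mathbb{Z},n\in\mathbb{N}_0}$ computed with the scheme $$u_j^{n+1}=u_j^n+\bigl(A_{j+1/2}^n(u_{j+1}^n-u_j^n)-B_{j-1/2}^n(u_j^n-u_{j-1}^n)\bigr)W_0+\sum_{k=1}^{r+1}\bigl(C_{j,j+k}^n(u_{j+k}^n-u_j^n)-D_{j-k,j}^n(u_j^n-u_{j-k}^n)\bigr)\frac1kW_k$$ enjoy the discrete maximum principle $$\inf_iu_i^n\le u_j^{n+1}\le\sup_iu_i^n\qquad\text{for all }n,j.$$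
   Context: All quantities are real; $j$ ranges over $\mathbb{Z}$ and $n$ over $\mathbb{N}_0=\{0,1,2,\dots\}$. Infimum and supremum are over $i\in\mathbb{Z}$. *)

(* Defs.v *)
From HB Require Import structures.
From mathcomp Require Import all_boot all_order all_algebra.
From mathcomp Require Import all_classical all_reals all_analysis.

Set Implicit Arguments.
Unset Strict Implicit.
Unset Printing Implicit Defensive.

Import Order.TTheory GRing.Theory Num.Theory.
Local Open Scope ring_scope.

(* Half-integer indices are shifted down: [A n j] and [B n j] stand for
   A_{j+1/2}^n and B_{j+1/2}^n, so B_{j-1/2}^n is [B n (j - 1)].  The families
   C and D take their two spatial indices literally: C_{j,j+k}^n is
   [C n j (j + k%:Z)] and D_{j-k,j}^n is [D n (j - k%:Z) j]. *)

Definition nonneg_coefficients (R : realType) (r : nat)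
    (A B : nat -> int -> R) (C D : nat -> int -> int -> R) : Prop :=
  forall (n : nat) (j : int),
    [/\ 0 <= A n j,
        0 <= B n j,
        forall k : nat, (k <= r.+1)%N -> 0 <= C n j (j + k%:Z) &
        forall k : nat, (k <= r.+1)%N -> 0 <= D n (j - k%:Z) j].

Definition cfl_condition (R : realType) (r : nat) (W : nat -> R)
    (A B : nat -> int -> R) (C D : nat -> int -> int -> R) : Prop :=
  forall (n : nat) (j : int),
    (A n j + B n (j - 1)) * W 0%N
    + \sum_(1 <= k < r.+2)
        (C n j (j + k%:Z) + D n (j - k%:Z) j) * (1 / k%:R) * W k <= 1.

Definition scheme_solution (R : realType) (r : nat) (W : nat -> R)
    (A B : nat -> int -> R) (C D : nat -> int -> int -> R)
    (u : nat -> int -> R) : Prop :=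
  forall (n : nat) (j : int),
    u n.+1 j =
      u n j
      + (A n j * (u n (j + 1) - u n j)
         - B n (j - 1) * (u n j - u n (j - 1))) * W 0%N
      + \sum_(1 <= k < r.+2)
          (C n j (j + k%:Z) * (u n (j + k%:Z) - u n j)
           - D n (j - k%:Z) j * (u n j - u n (j - k%:Z))) * (1 / k%:R) * W k.

(* Main.v *)
Require Import Defs.
From HB Require Import structures.
From mathcomp Require Import all_boot all_order all_algebra.
From mathcomp Require Import all_classical all_reals all_analysis.
From mathcomp Require Import ring.

(** Put theta for the left-hand side of the CFL condition.  Since every
    difference in the scheme compares some [u n i] with [u n j], the scheme says
    that [u n.+1 j] is the combination of [u n j], with weight [1 - theta], and
    of the neighbouring values, with the weights [A W_0], [B W_0], [C W_k / k]
    and [D W_k / k].  The signs of the coefficients and the CFL condition make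
    all weights nonnegative, and they add up to one, so [u n.+1 j] lies in the
    convex hull of the values at time [n].

    Convexity is used in the form of one finite bound, [scheme_step_le]: a real
    upper bound at time [n] persists at time [n.+1].  The scheme is linear, so
    negating the solution turns this into the statement for lower bounds.
    Infinite suprema and infima are harmless: where they do not make the claim
    trivial they are excluded because the value [u n j] is finite. *)

Set Implicit Arguments.
Unset Strict Implicit.
Unset Printing Implicit Defensive.

Import Order.TTheory GRing.Theory Num.Theory.
Local Open Scope classical_set_scope.
Local Open Scope ring_scope.

(** With [theta] as in the CFL condition, the gap below [M] evolves by
    [M - u n.+1 j = (1 - theta) * (M - u n j) + nonneg], where [nonneg] collects
    the weighted gaps at the neighbours of [j]. *)
Lemma scheme_step_le (R : realType) (r : nat) (W : nat -> R)
    (A B : nat -> int -> R) (C D : nat -> int -> int -> R) (u : nat -> int -> R)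
    (n : nat) (M : R) :
  (forall k : nat, (k <= r.+1)%N -> 0 <= W k) ->
  nonneg_coefficients r A B C D ->
  cfl_condition r W A B C D ->
  scheme_solution r W A B C D u ->
  (forall i, u n i <= M) -> forall j, u n.+1 j <= M.
Proof.
move=> hW hpos hcfl hu uM j.
have [A0 _ C0 D0] := hpos n j; have [_ B0 _ _] := hpos n (j - 1).
have gap0 i : 0 <= M - u n i by rewrite subr_ge0.
have W00 : 0 <= W 0%N by exact: hW.
have := hcfl n j; set theta1 := \sum_(1 <= k < _) _ => cfl.
pose near_gap := (A n j * (M - u n (j + 1)) + B n (j - 1) * (M - u n (j - 1)))
  * W 0%N.
pose far_gap := \sum_(1 <= k < r.+2)
  (C n j (j + k%:Z) * (M - u n (j + k%:Z))
   + D n (j - k%:Z) j * (M - u n (j - k%:Z))) * (1 / k%:R) * W k.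
have near0 : 0 <= near_gap by rewrite mulr_ge0 ?addr_ge0 ?mulr_ge0.
have far0 : 0 <= far_gap.
  rewrite /far_gap big_nat; apply: sumr_ge0 => k /andP[_ kr].
  rewrite mulr_ge0 ?hW// mulr_ge0 ?divr_ge0//.
  by rewrite addr_ge0// mulr_ge0 ?C0 ?D0.
(* Differences of values are differences of gaps:
   [u n i - u n j = (M - u n j) - (M - u n i)]. *)
rewrite -subr_ge0 (hu n j).
have -> : \sum_(1 <= k < r.+2)
    (C n j (j + k%:Z) * (u n (j + k%:Z) - u n j)
     - D n (j - k%:Z) j * (u n j - u n (j - k%:Z))) * (1 / k%:R) * W k
    = theta1 * (M - u n j) - far_gap.
  rewrite /theta1 /far_gap mulr_suml -sumrB; apply: eq_bigr => k _.
  by move: (1 / k%:R) => c; ring.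
set theta := _ + theta1 in cfl.
have -> : M - (u n j + (A n j * (u n (j + 1) - u n j)
      - B n (j - 1) * (u n j - u n (j - 1))) * W 0%N
      + (theta1 * (M - u n j) - far_gap))
    = (1 - theta) * (M - u n j) + near_gap + far_gap.
  by rewrite /theta /near_gap; ring.
by rewrite !addr_ge0// mulr_ge0// subr_ge0.
Qed.

Lemma scheme_solutionN (R : realType) (r : nat) (W : nat -> R)
    (A B : nat -> int -> R) (C D : nat -> int -> int -> R)
    (u : nat -> int -> R) :
  scheme_solution r W A B C D u ->
  scheme_solution r W A B C D (fun n i => - u n i).
Proof.
move=> hu n j; rewrite hu !opprD -sumrN; congr (_ + _ + _); first by ring.
by apply: eq_bigr => k _; move: (1 / k%:R) => c; ring.
Qed.

(** This lets finite bounds control a supremum taken in the extended reals: a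
    supremum that is real is itself an admissible [M], [+oo] bounds everything,
    and the value at [i0] rules out [-oo]. *)
Lemma le_ereal_sup_range (R : realType) (I : Type) (i0 : I) (f : I -> R)
    (x : R) :
  (forall M, (forall i, f i <= M) -> x <= M) ->
  (x%:E <= ereal_sup (range (fun i => (f i)%:E)))%E.
Proof.
move=> xM.
have ub i : ((f i)%:E <= ereal_sup (range (fun i => (f i)%:E)))%E.
  by apply: ereal_sup_ubound; exists i.
case: (ereal_sup _) ub => [M| |] ub; last by have := ub i0.
  by rewrite lee_fin; apply: xM => i; rewrite -lee_fin.
exact: leey.
Qed.

Lemma ereal_inf_range_le (R : realType) (I : Type) (i0 : I) (f : I -> R)
    (x : R) :
  (forall m, (forall i, m <= f i) -> m <= x) ->
  (ereal_inf (range (fun i => (f i)%:E)) <= x%:E)%E.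
Proof.
move=> mx.
have lb i : (ereal_inf (range (fun i => (f i)%:E)) <= (f i)%:E)%E.
  by apply: ereal_inf_lbound; exists i.
case: (ereal_inf _) lb => [m| |] lb; first last.
- exact: leNye.
- by have := lb i0.
by rewrite lee_fin; apply: mx => i; rewrite -lee_fin.
Qed.

(* Infimum and supremum are taken in the extended reals, since u^n is not
   assumed bounded. *)
Theorem lemma3p2 (R : realType) (r : nat) (W : nat -> R)
    (hW0 : forall k : nat, (k <= r.+1)%N -> 0 <= W k)
    (hW1 : \sum_(0 <= k < r.+2) W k = 1)
    (A B : nat -> int -> R) (C D : nat -> int -> int -> R)
    (hpos : nonneg_coefficients r A B C D)
    (hcfl : cfl_condition r W A B C D)
    (u : nat -> int -> R)
    (hu : scheme_solution r W A B C D u) :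
  forall (n : nat) (j : int),
    (ereal_inf (range (fun i : int => (u n i)%:E)) <= (u n.+1 j)%:E)%E /\
    ((u n.+1 j)%:E <= ereal_sup (range (fun i : int => (u n i)%:E)))%E.
Proof.
move=> n j; split.
  apply: (ereal_inf_range_le j) => m um; rewrite -lerN2.
  by apply: (scheme_step_le hW0 hpos hcfl (scheme_solutionN hu)) => i; rewrite lerN2.
apply: (le_ereal_sup_range j) => M uM.
exact: (scheme_step_le hW0 hpos hcfl hu uM).
Qed.
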